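(* Consider ParaOpt for a tracking objective applied to a linear diffusive equation, and suppose that assumptions (i)-(iii) of the context hold for the fine and coarse propagators. Let $\rho$ be the ParaOpt convergence factor, i.e. the spectral radius of $S=I-\tilde A^{-1}A$. Then $$\rho<\rho^*:=\max_{\sigma\in\mathrm{eig}(K)}\sqrt{\frac{(\tilde\varphi-\varphi)^2+(\tilde\psi-\psi)^2}{(1-\tilde\varphi)^2+\tilde\psi^2}}.$$
   Context: Let $M\ge1$ and $\widehat L\ge 1$ be integers ($M$ is the state dimension; for tracking with $L$ equal time sub-intervals, $\widehat L=L-1$). The tracking problem is to minimize $\frac12\int_0^T\|\mathbf y(t)-\mathbf y_{\mathrm d}(t)\|_2^2\,dt+\frac\gamma2\int_0^T\|\mathbf u(t)\|_2^2\,dt$ with $\gamma>0$, subject to the state equation with given initial value. ''Linear diffusive'' means the state equation is $\mathbf y'(t)=-K\mathbf y(t)+\mathbf u(t)$ with $K=K^\top\in\mathbb R^{M\times M}$ having only positive eigenvalues $\sigma$. ParaOpt solves the optimality system in the state $\mathbf y$ and the rescaled adjoint $\boldsymbol\lambda=-\sqrt\gamma\,\mathbf u$; on each sub-interval, the propagator $\mathcal P$ (fine) or $\tilde{\mathcal P}$ (coarse) maps the state at the left end and the rescaled adjoint at the right end to an approximation of the state at the right end, and $\mathcal Q$ or $\tilde{\mathcal Q}$ maps the same data to an approximation of the rescaled adjoint at the left end. Assumptions. (i) On each sub-interval $l$ the fine propagators are affine, $\mathcal P(\mathbf y,\boldsymbol\lambda)=\Phi_{\mathcal P}\mathbf y-\Psi_{\mathcal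 P}\boldsymbol\lambda+\mathbf b_{\mathcal P,l}$ and $\mathcal Q(\mathbf y,\boldsymbol\lambda)=\Psi_{\mathcal Q}\mathbf y+\Phi_{\mathcal Q}\boldsymbol\lambda+\mathbf b_{\mathcal Q,l}$, with matrices in $\mathbb R^{M\times M}$ independent of $l$; the coarse propagators $\tilde{\mathcal P},\tilde{\mathcal Q}$ have the same form with matrices $\tilde\Phi_{\mathcal P},\tilde\Psi_{\mathcal P},\tilde\Psi_{\mathcal Q},\tilde\Phi_{\mathcal Q}$. (ii) $\Phi_{\mathcal P}=\Phi_{\mathcal Q}=:\Phi$, $\Psi_{\mathcal P}=\Psi_{\mathcal Q}=:\Psi$, likewise $\tilde\Phi_{\mathcal P}=\tilde\Phi_{\mathcal Q}=:\tilde\Phi$, $\tilde\Psi_{\mathcal P}=\tilde\Psi_{\mathcal Q}=:\tilde\Psi$, and $K,\Phi,\Psi,\tilde\Phi,\tilde\Psi$ are simultaneously diagonalizable; their corresponding eigenvalues (for a common eigenvector) are denoted $\sigma,\varphi,\psi,\tilde\varphi,\tilde\psi$. (iii) All these eigenvalues satisfy $0<\varphi<1$, $0<\tilde\varphi<1$, $\psi>0$, $\tilde\psi>0$. The notation $\max_{\sigma\in\mathrm{eig}(K)}$ means the maximum over the eigenvalues of $K$ counted with multiplicity, i.e. over the common eigenvectors, each with its tuple $(\sigma,\varphi,\psi,\tilde\varphi,\tilde\psi)$. Let $N\in\mathbb R^{\widehat L\times\widehat L}$ have ones on its first sub-diagonal and zeros elsewhere. With $\otimes$ the Kronecker product and $I$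 identity matrices of the appropriate sizes, $$A=\begin{bmatrix} I\otimes I-N\otimes\Phi & I\otimes\Psi\\ -I\otimes\Psi & I\otimes I-N^\top\otimes\Phi\end{bmatrix},\qquad \tilde A=\begin{bmatrix} I\otimes I-N\otimes\tilde\Phi & I\otimes\tilde\Psi\\ -I\otimes\tilde\Psi & I\otimes I-N^\top\otimes\tilde\Phi\end{bmatrix}$$ (matrices of size $2M\widehat L$). In this setting the matching conditions at the sub-interval boundaries read $A\mathbf x=\mathbf b$, where $\mathbf x$ stacks the boundary states and then the boundary rescaled adjoints and $\mathbf b$ is a fixed vector. The ParaOpt iteration is $\mathbf x^{k}=(I-\tilde A^{-1}A)\mathbf x^{k-1}+\tilde A^{-1}\mathbf b$, $S=I-\tilde A^{-1}A$ is the ParaOpt iteration matrix, and the convergence factor $\rho$ is the spectral radius of $S$.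
   Formalization: The formal theorem additionally assumes that the coarse matrices are not both equal to the fine ones (not both Φ̃=Φ and Ψ̃=Ψ); if they coincide, S=0 and ρ=ρ*=0, so the strict inequality fails. *)

(* Defs.v *)
From mathcomp Require Import all_boot all_order all_algebra.
From mathcomp Require Import complex mxtens.
From mathcomp Require Import all_classical all_reals.

Set Implicit Arguments.
Unset Strict Implicit.
Unset Printing Implicit Defensive.

Import Order.TTheory GRing.Theory Num.Theory.

Local Open Scope ring_scope.
Local Open Scope classical_set_scope.

(* The set of moduli is finite and, for n > 0, nonempty, so [sup] is its
   maximum. *)
Definition spectral_radius (R : realType) (n : nat) (S : 'M[R]_n) : R :=
  sup [set r : R | exists2 z : complex R,
         eigenvalue (map_mx (real_complex R) S) z &
         r = ComplexField.Normc.normc z].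

Section ParaOpt.
Variable R : realType.

(* This describes the state equation y' = - K y + u. *)
Definition linear_diffusive (M : nat) (K : 'M[R]_M) : Prop :=
  K^T = K /\ (forall s : R, eigenvalue K s -> 0 < s).

(* [P l y lam] approximates the state at the right end of sub-interval [l] and
   [Q l y lam] the rescaled adjoint at its left end, from the state [y] at the
   left end and the rescaled adjoint [lam] at the right end. *)
Definition affine_propagators (M L : nat) (PhiP PsiP PsiQ PhiQ : 'M[R]_M)
    (P Q : 'I_L -> 'cV[R]_M -> 'cV[R]_M -> 'cV[R]_M) : Prop :=
  exists bP bQ : 'I_L -> 'cV[R]_M, forall (l : 'I_L) (y lam : 'cV[R]_M),
    P l y lam = PhiP *m y - PsiP *m lam + bP l /\
    Q l y lam = PsiQ *m y + PhiQ *m lam + bQ l.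

Definition joint_eigenvector (M : nat) (K Phi Psi tPhi tPsi : 'M[R]_M)
    (s phi psi tphi tpsi : R) (v : 'cV[R]_M) : Prop :=
  v != 0 /\
  [/\ K *m v = s *: v, Phi *m v = phi *: v, Psi *m v = psi *: v,
      tPhi *m v = tphi *: v & tPsi *m v = tpsi *: v].

Definition subdiag_mx (n : nat) : 'M[R]_n :=
  \matrix_(i, j) (i == j.+1 :> nat)%:R.

Definition paraopt_mx (M Lhat : nat) (Phi Psi : 'M[R]_M)
    : 'M[R]_(Lhat * M + Lhat * M) :=
  let I : 'M[R]_Lhat := 1%:M in
  let N := subdiag_mx Lhat in
  block_mx (I *t 1%:M - N *t Phi) (I *t Psi)
           (- (I *t Psi)) (I *t 1%:M - N^T *t Phi).

Definition paraopt_iteration_mx (M Lhat : nat) (Phi Psi tPhi tPsi : 'M[R]_M)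
    : 'M[R]_(Lhat * M + Lhat * M) :=
  1%:M - invmx (paraopt_mx Lhat tPhi tPsi) *m paraopt_mx Lhat Phi Psi.

(* The set is finite and, for simultaneously diagonalizable matrices with
   M > 0, nonempty, so [sup] is its maximum. *)
Definition rho_star (M : nat) (K Phi Psi tPhi tPsi : 'M[R]_M) : R :=
  sup [set r : R | exists s phi psi tphi tpsi v,
         joint_eigenvector K Phi Psi tPhi tPsi s phi psi tphi tpsi v /\
         r = Num.sqrt (((tphi - phi) ^+ 2 + (tpsi - psi) ^+ 2) /
                       ((1 - tphi) ^+ 2 + tpsi ^+ 2))].

End ParaOpt.

(* Main.v *)
(* A nonzero eigenvalue mu = 1/w of S gives a nonzero kernel vector of the
   ParaOpt matrix with parameters p = tphi - w (tphi - phi) and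
   q = tpsi - w (tpsi - psi), where (phi, psi, tphi, tpsi) belongs to one joint
   eigenvector. Eliminating the second half of that vector leaves
   y (1 - p N) (1 - p N^T) = - q^2 y, and pairing with the conjugate of y turns
   this into a quadratic equation for w with REAL coefficients (they involve
   |y|^2, |y N|^2 and Re (y N y^* )). It has no real root, so w is one of two
   conjugate roots and |w|^2 is their product, the ratio of the constant to the
   leading coefficient; this ratio is estimated directly. *)
Require Import Defs.
From mathcomp Require Import all_boot all_order all_algebra.
From mathcomp Require Import all_classical all_reals.
From mathcomp Require Import complex mxtens ring lra.

Set Implicit Arguments.
Unset Strict Implicit.
Unset Printing Implicit Defensive.

Import Order.TTheory GRing.Theory Num.Theory.

Local Open Scope ring_scope.

(** * The shift pencil and its real quadratic form *)

(** The matrix is lower triangular with unit diagonal, so its determinant is 1 for every [p]. *)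
Lemma subdiag_pencil_unit (R : realType) (L : nat) (p : complex R) :
  1%:M - p *: map_mx (real_complex R) (subdiag_mx R L) \in unitmx.
Proof.
rewrite unitmxE det_trig.
  rewrite big1 ?unitr1 // => i _; rewrite !mxE eqxx.
  by rewrite (ltn_eqF (ltnSn i)) rmorph0 mulr0 subr0.
apply/is_trig_mxP => i j ij; rewrite !mxE.
rewrite (ltn_eqF (leqW ij)) rmorph0 mulr0 subr0.
by case: eqP ij => // ->; rewrite ltnn.
Qed.

(** Valued in [R], not in the complex numbers: its values become the real coefficients of the
    quadratic. Row vectors match the left eigenvectors of [eigenvalue]. *)
Definition sqr_nrm (R : realType) (L : nat) (v : 'rV[complex R]_L) : R :=
  \sum_i (complex.Re (v 0 i) ^+ 2 + complex.Im (v 0 i) ^+ 2).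

Lemma sqr_nrm_ge0 (R : realType) (L : nat) (v : 'rV[complex R]_L) :
  0 <= sqr_nrm v.
Proof. by apply: sumr_ge0 => i _; rewrite addr_ge0 // sqr_ge0. Qed.

Lemma sqr_nrm_gt0 (R : realType) (L : nat) (v : 'rV[complex R]_L) :
  v != 0 -> 0 < sqr_nrm v.
Proof.
rewrite lt_def sqr_nrm_ge0 andbT; apply: contraNneq => v0.
apply/eqP/rowP => i; rewrite mxE.
have ge0 j : true -> 0 <= complex.Re (v 0 j) ^+ 2 + complex.Im (v 0 j) ^+ 2.
  by rewrite addr_ge0 // sqr_ge0.
have /eqP : complex.Re (v 0 i) ^+ 2 + complex.Im (v 0 i) ^+ 2 = 0.
  by apply: (psumr_eq0P ge0 v0).
rewrite paddr_eq0 ?sqr_ge0 // !sqrf_eq0.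
by case: (v 0 i) => x y /= /andP[/eqP-> /eqP->].
Qed.

Lemma mulmx_conj_tr (R : realType) (L : nat) (v : 'rV[complex R]_L) :
  (v *m (map_mx (@conjc R) v)^T) 0 0 = real_complex R (sqr_nrm v).
Proof.
rewrite mxE rmorph_sum /=; apply: eq_bigr => i _; rewrite !mxE.
case: (v 0 i) => x y /=; apply/eqP; rewrite eq_complex /=; apply/andP.
by split; apply/eqP; ring.
Qed.

(** Since [Z] is real, conjugation fixes it, and the transpose of [Zc] is also its adjoint. *)
Lemma mulmx_gram_conj_tr (R : realType) (L : nat) (v : 'rV[complex R]_L)
    (Z : 'M[R]_L) :
  let Zc := map_mx (real_complex R) Z in
  (v *m (Zc *m Zc^T) *m (map_mx (@conjc R) v)^T) 0 0
    = real_complex R (sqr_nrm (v *m Zc)).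
Proof.
move=> Zc; rewrite -mulmx_conj_tr map_mxM /= trmx_mul !mulmxA.
congr ((_ *m _ *m _) 0 0); congr (_^T); apply/matrixP => i j.
by rewrite !mxE; apply/eqP; rewrite eq_complex /= oppr0 !eqxx.
Qed.

Lemma sqr_nrm_shift (R : realType) (L : nat) (v : 'rV[complex R]_L) :
  sqr_nrm (v *m map_mx (real_complex R) (subdiag_mx R L)) <= sqr_nrm v.
Proof.
case: L v => [|L] v; first by rewrite /sqr_nrm !big_ord0.
have vN i : (v *m map_mx (real_complex R) (subdiag_mx R L.+1)) 0 i
    = \sum_(k < L.+1 | (k == i.+1 :> nat)) v 0 k.
  rewrite mxE [RHS]big_mkcond; apply: eq_bigr => k _; rewrite !mxE.
  by case: eqP => _; rewrite ?rmorph1 ?rmorph0 ?mulr1 ?mulr0.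
(* Entry [i] of [v *m N] is entry [i + 1] of [v], and the last entry is 0. So the last term on the
   left is compared with the first on the right, and the remaining sums agree termwise. *)
rewrite /sqr_nrm big_ord_recr big_ord_recl /= addrC lerD //; last first.
  apply: ler_sum => i _; by rewrite vN (big_pred1 (lift ord0 i)).
rewrite vN big_pred0 /= ?expr0n ?addr0 ?addr_ge0 ?sqr_ge0 // => k.
by rewrite ltn_eqF.
Qed.

(* Here [n = |y|^2], [t = |y N|^2] and [g = Re (y N y^* )], and the positive
   quadratic in [s] is [|y (1 - s N)|^2]. *)
Lemma pencil_kernel_quadratic (R : realType) (L : nat) (p q : complex R)
    (y l : 'rV[complex R]_L) :
  let N := map_mx (real_complex R) (subdiag_mx R L) in
  (y != 0) || (l != 0) ->
  y *m (1%:M - p *: N) = q *: l ->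
  l *m (1%:M - p *: N^T) = - (q *: y) ->
  exists n t g : R, [/\ 0 <= t <= n, forall s : R, 0 < n + t * s ^+ 2 - 2 * g * s
    & real_complex R n * (1 + q ^+ 2) + real_complex R t * p ^+ 2
      - 2 * real_complex R g * p = 0].
Proof.
move=> N yl0 Ey El.
have y0 : y != 0.
  apply: contraTneq yl0 => y0; rewrite y0 eqxx /= negbK; apply/eqP.
  have U : 1%:M - p *: N^T \in unitmx.
    by rewrite -unitmx_tr linearB /= trmx1 linearZ /= trmxK subdiag_pencil_unit.
  apply: (can_inj (mulmxK U)).
  by rewrite El y0 mul0mx scaler0 oppr0.
pose F X : complex R := (y *m X *m (map_mx (@conjc R) y)^T) 0 0.
have FD A B : F (A + B) = F A + F B by rewrite /F mulmxDr mulmxDl mxE.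
have FZ c A : F (c *: A) = c * F A by rewrite /F -scalemxAr -scalemxAl mxE.
pose n := sqr_nrm y; pose t := sqr_nrm (y *m N).
(* Polarization at [s = 1]: [g] is read off from |y (1 - N)|^2 = n + t - 2 g, which makes it real by
   construction. *)
pose g := (n + t - sqr_nrm (y *m map_mx (real_complex R) (1%:M - subdiag_mx R L))) / 2.
have F1 : F 1%:M = real_complex R n by rewrite /F mulmx1 mulmx_conj_tr.
have Ft : F (N *m N^T) = real_complex R t by rewrite /F mulmx_gram_conj_tr.
have expand c : (1%:M - c *: N) *m (1%:M - c *: N^T)
    = 1%:M + c ^+ 2 *: (N *m N^T) + (- c) *: (N + N^T).
  rewrite mulmxBr mulmx1 mulmxBl mul1mx -scalemxAr -scalemxAl scalerA expr2.
  by apply/matrixP => i j; rewrite !mxE; ring.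
(* For complex [c] this is not a squared norm: [c] is not conjugated, so the value stays polynomial
   in [c]. *)
have Fexp c : F ((1%:M - c *: N) *m (1%:M - c *: N^T))
    = real_complex R n + c ^+ 2 * real_complex R t - c * F (N + N^T).
  by rewrite expand 2!FD !FZ F1 Ft; ring.
have Fs (s : R) : F ((1%:M - real_complex R s *: N) *m (1%:M - real_complex R s *: N^T))
    = real_complex R (sqr_nrm (y *m (1%:M - real_complex R s *: N))).
  have E : 1%:M - real_complex R s *: N
    = map_mx (real_complex R) (1%:M - s *: subdiag_mx R L).
    by rewrite map_mxB map_mx1 map_mxZ.
  have E' : 1%:M - real_complex R s *: N^T = (1%:M - real_complex R s *: N)^T.
    by apply/matrixP => i j; rewrite !mxE eq_sym.
  by rewrite E' E -mulmx_gram_conj_tr.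
have Fg : F (N + N^T) = 2 * real_complex R g.
  have := Fexp 1; have := Fs 1; rewrite rmorph1 => -> .
  have -> : 1%:M - 1 *: N = map_mx (real_complex R) (1%:M - subdiag_mx R L).
    by rewrite map_mxB map_mx1 scale1r.
  move=> E; rewrite /g rmorphM fmorphV rmorphB rmorphD rmorph_nat /= E.
  by field.
exists n, t, g; split.
- by rewrite sqr_nrm_ge0 sqr_nrm_shift.
- move=> s; suff -> : n + t * s ^+ 2 - 2 * g * s
      = sqr_nrm (y *m (1%:M - real_complex R s *: N)).
    apply: sqr_nrm_gt0; apply: contraNneq y0 => E.
    apply/eqP/(can_inj (mulmxK (subdiag_pencil_unit L (real_complex R s)))).
    by rewrite E mul0mx.
  apply: (fmorph_inj (real_complex R)) => /=; rewrite -Fs Fexp Fg.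
  by rewrite rmorphB rmorphD !rmorphM rmorph_nat /=; ring.
(* At [c = p] the two kernel equations give y (1 - p N) (1 - p N^T) = - q^2 y, so the left side of
   [Fexp] is - q^2 n. *)
- have := Fexp p; rewrite {1}/F mulmxA Ey -scalemxAl El scalerN scalerA -expr2.
  rewrite mulNmx -scalemxAl mxE [X in - X]mxE mulmx_conj_tr -/n Fg => E.
  transitivity (real_complex R n + p ^+ 2 * real_complex R t
    - p * (2 * real_complex R g) + q ^+ 2 * real_complex R n); first by ring.
  by rewrite -E addNr.
Qed.

(** * Modulus of the roots of the quadratic *)

Lemma quadratic_root_modulus (R : realType) (n t g a b f h : R) (w : complex R) :
  0 <= t <= n -> (forall s : R, 0 < n + t * s ^+ 2 - 2 * g * s) ->
  0 < f < 1 ->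
  (let p := real_complex R f - real_complex R a * w in
   let q := real_complex R h - real_complex R b * w in
   real_complex R n * (1 + q ^+ 2) + real_complex R t * p ^+ 2
     - 2 * real_complex R g * p = 0) ->
  (1 - f) ^+ 2 + h ^+ 2 < (a ^+ 2 + b ^+ 2) * (complex.Re w ^+ 2 + complex.Im w ^+ 2).
Proof.
move=> /andP[t0 tn] pos /andP[f0 f1] /=; case: w => x z /=.
move=> /eqP; rewrite eq_complex /= => /andP[/eqP Er /eqP Ei].
have n0 : 0 < n by have := pos 0; rewrite expr0n /= !mulr0 addr0 subr0.
(* The equation reads D w^2 - 2 B w + E = 0; [Ei'] and [Er'] are its imaginary part (halved) and its
   real part. *)
set D := t * a ^+ 2 + n * b ^+ 2.
set B := n * h * b + t * f * a - g * a.
set E := n + n * h ^+ 2 + t * f ^+ 2 - 2 * g * f.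
have Ei' : z * (D * x - B) = 0 by rewrite /D /B; lra.
have Er' : E - 2 * B * x + D * (x ^+ 2 - z ^+ 2) = 0 by rewrite /D /B /E; lra.
(* For real [w], both p = f - a x and q are real, and the left side is n q^2 plus the value of the
   positive quadratic at p. *)
have zN0 : z != 0.
  apply/eqP => z0; have := pos (f - a * x).
  have := sqr_ge0 (h - b * x); move: Er; rewrite z0; nra.
have DB : D * x = B.
  by apply/eqP; rewrite -subr_eq0; move/eqP: Ei'; rewrite mulf_eq0 (negPf zN0).
have ED : E = D * (x ^+ 2 + z ^+ 2).
  by apply/eqP; rewrite -subr_eq0 -Er' -DB; apply/eqP; ring.
have g1 : 2 * g < n + t by have := pos 1; rewrite expr1n !mulr1; lra.
(* Strictness of the final bound arises here, from f > 0 and n + t > 2 g; the other term uses t <= n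
   and f < 1. *)
have lowE : n * ((1 - f) ^+ 2 + h ^+ 2) < E.
  rewrite -subr_gt0.
  have -> : E - n * ((1 - f) ^+ 2 + h ^+ 2)
    = f * (n + t - 2 * g) + f * (n - t) * (1 - f) by rewrite /E; ring.
  by apply: ltr_pwDl; [apply: mulr_gt0; lra | apply: mulr_ge0; [apply: mulr_ge0|]; lra].
have upD : D <= n * (a ^+ 2 + b ^+ 2).
  by rewrite mulrDr lerD2r ler_wpM2r // sqr_ge0.
rewrite -(ltr_pM2l n0); apply: lt_le_trans lowE _.
by rewrite ED mulrA ler_wpM2r // addr_ge0 // sqr_ge0.
Qed.

(** * Kronecker structure and reduction to one joint eigenvector *)

(** The shape of [paraopt_mx] over any commutative ring, so that complex combinations of the blocks
    are covered. *)
Definition kron_pencil (C : comNzRingType) (L M : nat) (N : 'M[C]_L) (F H : 'M[C]_M)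
    : 'M[C]_(L * M + L * M) :=
  block_mx (1%:M *t 1%:M - N *t F) (1%:M *t H)
           (- (1%:M *t H)) (1%:M *t 1%:M - N^T *t F).

Lemma map_paraopt_mx (R : realType) (L M : nat) (Phi Psi : 'M[R]_M) :
  map_mx (real_complex R) (paraopt_mx L Phi Psi)
    = kron_pencil (map_mx (real_complex R) (subdiag_mx R L))
        (map_mx (real_complex R) Phi) (map_mx (real_complex R) Psi).
Proof.
by rewrite /paraopt_mx /kron_pencil map_block_mx map_mxN !map_mxB !map_mxT
           !map_mx1 map_trmx.
Qed.

(** The pencil is affine in [(F, H)], so an affine combination of the coarse and fine ParaOpt
    matrices is again such a matrix. *)
Lemma kron_pencil_line (C : comNzRingType) (L M : nat) (N : 'M[C]_L)
    (F F' H H' : 'M[C]_M) (w : C) :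
  kron_pencil N (F - w *: (F - F')) (H - w *: (H - H'))
    = kron_pencil N F H - w *: (kron_pencil N F H - kron_pencil N F' H').
Proof.
rewrite /kron_pencil !(opp_block_mx, add_block_mx, scale_block_mx).
by congr block_mx; apply/matrixP => i j; rewrite !mxE; ring.
Qed.

(** Right multiplication by it pairs each length-[M] block of a row vector with [v]. The cast turns
    the width [L * 1] into [L]. *)
Definition kron_slice (C : comNzRingType) (L M : nat) (v : 'cV[C]_M) : 'M[C]_(L * M, L) :=
  castmx (erefl, muln1 L) ((1%:M : 'M_L) *t v).

Lemma mulmx_kron_slice (C : comNzRingType) (L M : nat) (X : 'M[C]_L) (F : 'M[C]_M)
    (v : 'cV[C]_M) (f : C) :
  F *m v = f *: v -> (X *t F) *m kron_slice L v = f *: (kron_slice L v *m X).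
Proof.
move=> Fv.
have castl m n (e : n = L) (A : 'M[C]_(m, n)) :
    castmx (erefl, e) A *m X = castmx (erefl, e) (A *m castmx (esym e, esym e) X).
  by case: L / e X; rewrite !castmx_id.
have castr m n k l (e : n = l) (A : 'M[C]_(m, k)) (B : 'M[C]_(k, n)) :
    A *m castmx (erefl, e) B = castmx (erefl, e) (A *m B).
  by case: l / e; rewrite !castmx_id.
have castZ m n l (e : n = l) (A : 'M[C]_(m, n)) :
    f *: castmx (erefl, e) A = castmx (erefl, e) (f *: A).
  by case: l / e; rewrite !castmx_id.
(* The cast of [X] is read as [X] tensored with the 1 by 1 identity, so both sides become Kronecker
   products. *)
rewrite /kron_slice castr castl castZ -[X in castmx (esym _, _) X]scale1r.
rewrite -tens_mx_scalar !tensmx_mul mulmx1 mul1mx mulmx1 Fv.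
by congr castmx; apply/matrixP => i j; rewrite !mxE; ring.
Qed.

(** The slices along all columns of [Q] are together the entries of y (I tensor Q), and I tensor Q
    has inverse I tensor Q^-1. *)
Lemma kron_slice_inj (C : fieldType) (L M : nat) (Q : 'M[C]_M) (y : 'rV[C]_(L * M)) :
  Q \in unitmx -> (forall j, y *m kron_slice L (col j Q) = 0) -> y = 0.
Proof.
move=> Qu y0; have U : (1%:M : 'M[C]_L) *t Q \in unitmx.
  have /mulmx1_unit[] // : ((1%:M : 'M[C]_L) *t Q) *m (1%:M *t invmx Q) = 1%:M.
  rewrite tensmx_mul mulmx1 mulmxV //; apply/matrixP => k k'.
  case: (mxtens_indexP k) => i j; case: (mxtens_indexP k') => i' j'.
  by rewrite tensmxE !mxE (can_eq (@mxtens_indexK _ _)) xpair_eqE -natrM mulnb.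
apply: (can_inj (mulmxK U)); rewrite mul0mx; apply/rowP => k.
case: (mxtens_indexP k) => i j; rewrite [RHS]mxE.
transitivity ((y *m kron_slice L (col j Q)) 0 i); last by rewrite y0 mxE.
rewrite !mxE; apply: eq_bigr => k' _; congr (_ * _); rewrite castmxE /=.
case: (mxtens_indexP k') => i' j'.
have -> : cast_ord (esym (muln1 L)) i = mxtens_index (i, ord0 : 'I_1).
  by apply: val_inj; rewrite /= muln1 addn0.
by rewrite cast_ord_id !tensmxE !mxE.
Qed.

(** Some column of [Q] gives a nonzero slice of [x]; along it [F] and [H] act as the scalars [f j]
    and [h j], which leaves the system of [pencil_kernel_quadratic]. *)
Lemma kron_pencil_kernel (R : realType) (L M : nat) (Q F H : 'M[complex R]_M)
    (f h : 'I_M -> complex R) (x : 'rV[complex R]_(L * M + L * M)) :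
  Q \in unitmx ->
  (forall j, F *m col j Q = f j *: col j Q) ->
  (forall j, H *m col j Q = h j *: col j Q) ->
  x != 0 ->
  x *m kron_pencil (map_mx (real_complex R) (subdiag_mx R L)) F H = 0 ->
  exists j, exists n t g : R,
    [/\ 0 <= t <= n, forall s : R, 0 < n + t * s ^+ 2 - 2 * g * s
      & real_complex R n * (1 + h j ^+ 2) + real_complex R t * f j ^+ 2
        - 2 * real_complex R g * f j = 0].
Proof.
set N := map_mx _ _ => Qu FQ HQ.
rewrite -[x]hsubmxK; set y := lsubmx x; set l := rsubmx x => x0.
rewrite /kron_pencil mul_row_block => /eqP.
rewrite -row_mx0 => /eqP/eq_row_mx[Ey El].
have /existsP[j yl0] : [exists j, (y *m kron_slice L (col j Q) != 0)
                               || (l *m kron_slice L (col j Q) != 0)].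
  apply: contra_neqT x0; rewrite negb_exists => /forallP z.
  have y0 : y = 0.
    by apply: (kron_slice_inj Qu) => j; have := z j; rewrite negb_or !negbK => /andP[/eqP].
  have l0 : l = 0.
    by apply: (kron_slice_inj Qu) => j; have := z j; rewrite negb_or !negbK => /andP[_ /eqP].
  by rewrite y0 l0 row_mx0.
exists j; have slice1 (z : 'rV_(L * M)) (G : 'M_M) c (X : 'M_L) :
    G *m col j Q = c *: col j Q ->
    z *m (X *t G) *m kron_slice L (col j Q) = c *: (z *m kron_slice L (col j Q) *m X).
  by move=> Gc; rewrite -mulmxA (mulmx_kron_slice _ Gc) -scalemxAr mulmxA.
have I1 : (1%:M : 'M[complex R]_M) *m col j Q = 1 *: col j Q by rewrite mul1mx scale1r.
apply: (pencil_kernel_quadratic yl0).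
- move/(congr1 (mulmx^~ (kron_slice L (col j Q)))): Ey.
  rewrite mul0mx mulmxDl mulmxBr mulmxBl mulmxN mulNmx !(slice1 _ _ _ _ I1).
  rewrite (slice1 _ _ _ _ (FQ j)) (slice1 _ _ _ _ (HQ j)) !mulmx1 scale1r.
  by move/subr0_eq; rewrite mulmxBr mulmx1 -scalemxAr.
- move/(congr1 (mulmx^~ (kron_slice L (col j Q)))): El.
  rewrite mul0mx mulmxDl mulmxBr mulmxBl !(slice1 _ _ _ _ I1).
  rewrite (slice1 _ _ _ _ (FQ j)) (slice1 _ _ _ _ (HQ j)) !mulmx1 scale1r.
  by move/eqP; rewrite addrC addr_eq0 => /eqP <-; rewrite mulmxBr mulmx1 -scalemxAr.
Qed.

(** * Joint eigenbases and strict bounds on the spectral radius *)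

(** [codiagonalizable] makes P A P^-1 diagonal, so the rows of [P] are left eigenvectors and the
    columns of P^-1 right ones. *)
Lemma codiagonalizable_eigenbasis (F : fieldType) (M : nat) (As : seq 'M[F]_M) :
  codiagonalizable As ->
  exists2 Q, Q \in unitmx & forall A, A \in As ->
    exists d : 'I_M -> F, forall j, A *m col j Q = d j *: col j Q.
Proof.
case=> P Pu /allP dP; exists (invmx P); first by rewrite unitmx_inv.
move=> A /dP; rewrite /= /similar_to conjumx // => /is_diag_mxP D.
exists (fun j => (P *m A *m invmx P) j j) => j.
have -> : A *m col j (invmx P) = invmx P *m col j (P *m A *m invmx P).
  by rewrite !colE !mulmxA mulVmx // mul1mx.
apply/colP => i; rewrite !mxE (bigD1 j) //= big1 => [|k kj].
  by rewrite addr0 mulrC !mxE.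
by rewrite [col _ _ _ _]mxE D ?mulr0.
Qed.

(** Strictness survives the supremum because the eigenvalues lie among the finitely many roots of
    the characteristic polynomial. [0 < m] covers the value 0 of an empty supremum and of the
    default in [\big[Num.max/0]]. *)
Lemma spectral_radius_lt (R : realType) (n : nat) (S : 'M[R]_n) (m : R) :
  0 < m ->
  (forall z, eigenvalue (map_mx (real_complex R) S) z ->
     ComplexField.Normc.normc z < m) ->
  spectral_radius S < m.
Proof.
move=> m0 lt_m; rewrite /spectral_radius; set E := (X in sup X).
have [[e Ee]|/set0P/negP/negPn/eqP E0] := pselect (E !=set0)%classic; last first.
  by rewrite E0 sup0.
have [rs char_rs] := closed_field_poly_normal (char_poly (map_mx (real_complex R) S)).
apply: (@le_lt_trans _ _
  (\big[Num.max/0]_(z <- rs | eigenvalue (map_mx (real_complex R) S) z)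
     ComplexField.Normc.normc z)); last by apply: bigmax_lt.
apply: ge_sup; first by exists e.
move=> _ [z ev_z ->]; apply: (@le_bigmax_seq _ _ _ _ _ z) => //.
move: (ev_z); rewrite eigenvalue_root_char char_rs rootZ ?root_prod_XsubC //.
by rewrite (eqP (char_poly_monic _)) oner_eq0.
Qed.

(** * The convergence factor against the joint eigenvalues *)

Theorem theorem3p10 (R : realType) (M Lhat : nat)
    (hM : (1 <= M)%N) (hL : (1 <= Lhat)%N)
    (K Phi Psi tPhi tPsi : 'M[R]_M)
    (P Q tP tQ : 'I_Lhat.+1 -> 'cV[R]_M -> 'cV[R]_M -> 'cV[R]_M)
    (hK : linear_diffusive K)
    (hfine : affine_propagators Phi Psi Psi Phi P Q)
    (hcoarse : affine_propagators tPhi tPsi tPsi tPhi tP tQ)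
    (hdiag : codiagonalizable [:: K; Phi; Psi; tPhi; tPsi])
    (heig : forall s phi psi tphi tpsi v,
        joint_eigenvector K Phi Psi tPhi tPsi s phi psi tphi tpsi v ->
        [/\ 0 < phi < 1, 0 < tphi < 1, 0 < psi & 0 < tpsi])
    (hneq : ~ (tPhi = Phi /\ tPsi = Psi)) :
  spectral_radius (paraopt_iteration_mx Lhat Phi Psi tPhi tPsi)
    < rho_star K Phi Psi tPhi tPsi.
Proof.
have [V Vu basis] := codiagonalizable_eigenbasis hdiag.
have mul_col (A : 'M[R]_M) j : col j (A *m V) = A *m col j V by rewrite !colE mulmxA.
have [s Ks] := basis K ltac:(by rewrite !inE eqxx ?orbT).
have [phi Phi_V] := basis Phi ltac:(by rewrite !inE eqxx ?orbT).
have [psi Psi_V] := basis Psi ltac:(by rewrite !inE eqxx ?orbT).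
have [tphi tPhi_V] := basis tPhi ltac:(by rewrite !inE eqxx ?orbT).
have [tpsi tPsi_V] := basis tPsi ltac:(by rewrite !inE eqxx ?orbT).
have joint j : joint_eigenvector K Phi Psi tPhi tPsi
    (s j) (phi j) (psi j) (tphi j) (tpsi j) (col j V).
  split=> //; apply: contraTneq Vu => V0; rewrite unitmxE (expand_det_col _ j).
  by rewrite big1 ?unitr0 // => i _; move/colP/(_ i): V0; rewrite !mxE => ->; rewrite mul0r.
have tphi01 j : 0 < tphi j < 1 by have [] := heig _ _ _ _ _ _ (joint j).
have tpsi0 j : 0 < tpsi j by have [] := heig _ _ _ _ _ _ (joint j).
pose num j := (tphi j - phi j) ^+ 2 + (tpsi j - psi j) ^+ 2.
pose den j := (1 - tphi j) ^+ 2 + tpsi j ^+ 2.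
pose rho j := Num.sqrt (num j / den j).
have den0 j : 0 < den j by rewrite ltr_wpDl ?sqr_ge0 // exprn_gt0.
have rho_ge0 j : 0 <= rho j by apply: sqrtr_ge0.
have rho_le j : rho j <= rho_star K Phi Psi tPhi tPsi.
  apply: ub_le_sup; last by exists (s j), (phi j), (psi j), (tphi j), (tpsi j), (col j V).
  (* The supremum needs an upper bound. Any joint eigenvector is [V *m c] with some [c i 0 != 0];
     comparing coordinate [i] for each matrix shows that its eigenvalues are those of column [i]. *)
  exists (\big[Num.max/0]_i rho i) => _ [s' [f [h [tf [th [v [[v0 [_ Ef Eh Etf Eth] ->]]]]]]]].
  have [c vE] : exists c, v = V *m c by exists (invmx V *m v); rewrite mulKVmx.
  have [i ci] : exists i, c i 0 != 0.
    apply/existsP; apply: contraNT v0; rewrite negb_exists => /forallP c0.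
    rewrite vE; suff -> : c = 0 by rewrite mulmx0.
    by apply/colP => i; rewrite mxE; apply/eqP; have := c0 i; rewrite negbK.
  have coord A (d : 'I_M -> R) e : (forall j, A *m col j V = d j *: col j V) ->
      A *m v = e *: v -> d i = e.
    move=> AV Av; apply: (mulIf ci).
    have AVD : A *m V = V *m diag_mx (\row_j d j).
      apply/matrixP => k l; have /colP/(_ k) := AV l.
      by rewrite -mul_col mxE => ->; rewrite mul_mx_diag !mxE mulrC.
    have /colP/(_ i) : diag_mx (\row_j d j) *m c = e *: c.
      by apply: (can_inj (mulKmx Vu)); rewrite mulmxA -AVD -mulmxA -vE Av vE -scalemxAr.
    by rewrite mul_diag_mx !mxE.
  rewrite -(coord _ _ _ Phi_V Ef) -(coord _ _ _ Psi_V Eh).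
  rewrite -(coord _ _ _ tPhi_V Etf) -(coord _ _ _ tPsi_V Eth).
  exact: (le_bigmax _ rho i).
(* If every [rho j] vanished, fine and coarse matrices would agree on the basis, against [hneq];
   both sides of the claim would then be 0. *)
have [j0 rho_j0] : exists j, 0 < rho j.
  apply: contrapT => no; apply: hneq.
  have same j : tphi j = phi j /\ tpsi j = psi j.
    have : num j <= 0.
      rewrite leNgt; apply/negP => num0; apply: no; exists j.
      by rewrite sqrtr_gt0 divr_gt0.
    rewrite le_eqVlt ltNge addr_ge0 ?sqr_ge0 // orbF paddr_eq0 ?sqr_ge0 //.
    by rewrite !sqrf_eq0 !subr_eq0 => /andP[/eqP-> /eqP->].
  have eq_on_basis (A B : 'M[R]_M) : (forall j, A *m col j V = B *m col j V) -> A = B.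
    move=> AB; apply: (can_inj (mulmxK Vu)); apply/matrixP => k j.
    by have /colP/(_ k) := AB j; rewrite -!mul_col mxE [RHS]mxE.
  by split; apply: eq_on_basis => j; have [e1 e2] := same j;
    rewrite ?tPhi_V ?tPsi_V ?Phi_V ?Psi_V ?e1 ?e2.
pose toC := real_complex R; pose VC := map_mx toC V.
have VCu : VC \in unitmx by rewrite map_unitmx.
have colC (A : 'M[R]_M) d : (forall j, A *m col j V = d j *: col j V) ->
    forall j, map_mx toC A *m col j VC = toC (d j) *: col j VC.
  by move=> AV j; rewrite -map_col -map_mxM AV map_mxZ.
(* A kernel vector would make n + t s^2 - 2 g s plus n tpsi^2 vanish at s = tphi, although the first
   part is positive. *)
have tA_unit : paraopt_mx Lhat tPhi tPsi \in unitmx.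
  rewrite -(map_unitmx toC) -row_free_unit; apply: inj_row_free => x xA.
  apply/eqP; apply/negPn/negP => x0; rewrite map_paraopt_mx in xA.
  have [j [n [t [g [/andP[t0 tn] pos]]]]] :=
    kron_pencil_kernel VCu (colC _ _ tPhi_V) (colC _ _ tPsi_V) x0 xA.
  have n0 : 0 < n by have := pos 0; rewrite expr0n /= !mulr0 addr0 subr0.
  move=> E; have {E} : n * (1 + tpsi j ^+ 2) + t * tphi j ^+ 2 - 2 * g * tphi j = 0.
    apply: (fmorph_inj toC); rewrite rmorph0 -E.
    by rewrite rmorphB rmorphD !rmorphM !rmorphD !rmorph1 !rmorphM.
  apply/eqP; rewrite gt_eqF //.
  have := mulr_ge0 (ltW n0) (sqr_ge0 (tpsi j)); have := pos (tphi j); lra.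
apply: (lt_le_trans (y := \big[Num.max/0]_j rho j)); last first.
  by apply: bigmax_le => //; apply: le_trans (rho_ge0 j0) (rho_le j0).
have rho_max j : rho j <= \big[Num.max/0]_j rho j by apply: le_bigmax.
apply: spectral_radius_lt; first exact: lt_le_trans rho_j0 (rho_max j0).
move=> z /eigenvalueP[u uS u0].
have [->|z0] := eqVneq z 0.
  by rewrite ComplexField.Normc.normc0; apply: lt_le_trans rho_j0 (rho_max j0).
set tAC := map_mx toC (paraopt_mx Lhat tPhi tPsi).
set AC := map_mx toC (paraopt_mx Lhat Phi Psi).
have tACu : tAC \in unitmx by rewrite map_unitmx.
(* With u = x tA, the eigenvalue equation becomes x (tA - A) = z x tA; dividing by [z] gives [xE]
   with w = 1/z. *)
pose x := u *m invmx tAC.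
have uE : u = x *m tAC by rewrite mulmxKV.
have x0 : x != 0 by apply: contraNneq u0 => x0; rewrite uE x0 mul0mx.
have xE : x *m (tAC - z^-1 *: (tAC - AC)) = 0.
  move: uS; rewrite map_mxB map_mx1 map_mxM map_invmx -/tAC -/AC.
  rewrite mulmxBr mulmx1 mulmxA -/x uE => uS.
  by rewrite mulmxBr -scalemxAr mulmxBr uS scalerA mulVf // scale1r subrr.
rewrite /tAC /AC !map_paraopt_mx -kron_pencil_line in xE.
have lineC (A B : 'M[R]_M) d e w : (forall j, A *m col j V = d j *: col j V) ->
    (forall j, B *m col j V = e j *: col j V) ->
    forall j, (map_mx toC A - w *: (map_mx toC A - map_mx toC B)) *m col j VC
      = (toC (d j) - toC (d j - e j) * w) *: col j VC.
  move=> AV BV j; rewrite mulmxBl -scalemxAl mulmxBl (colC _ _ AV) (colC _ _ BV).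
  by rewrite -scalerBl scalerA -scalerBl [_ * (_ - _)]mulrC -rmorphB.
have [j [n [t [g [tn pos]]]]] := kron_pencil_kernel VCu
  (lineC _ _ _ _ z^-1 tPhi_V Phi_V) (lineC _ _ _ _ z^-1 tPsi_V Psi_V) x0 xE.
move=> /(quadratic_root_modulus tn pos (tphi01 j)).
rewrite -/(den j) -/(num j).
have -> : complex.Re z^-1 ^+ 2 + complex.Im z^-1 ^+ 2
    = (ComplexField.Normc.normc z ^+ 2)^-1.
  rewrite -exprVn -ComplexField.Normc.normcV; case: (z^-1) => a b /=.
  by rewrite sqr_sqrtr // addr_ge0 // sqr_ge0.
have nz0 : 0 < ComplexField.Normc.normc z.
  rewrite lt_def; apply/andP; split; last by case: (z) => a b; apply: sqrtr_ge0.
  by apply: contraNneq z0 => /ComplexField.Normc.eq0_normc ->.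
(* The bound den < num / |z|^2 is rearranged to |z|^2 < num / den before taking square roots. *)
rewrite ltr_pdivlMr ?exprn_gt0 // mulrC -ltr_pdivlMr // => lt_num.
apply: lt_le_trans (rho_max j).
rewrite -[X in X < _]ger0_norm ?ltW // -sqrtr_sqr ltr_sqrt //.
by apply: lt_trans lt_num; rewrite exprn_gt0.
Qed.
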